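(* Let $G$ be an $n$-vertex triangle-free graph. If $G$ contains at least $k$ vertex-disjoint $P_3$'s, then $$\mathrm{MIS}(G)\le 2^{\frac{n}{2}-\frac{k}{25}}.$$
   Context: Graphs are finite and simple. $P_3$ denotes the path on $3$ vertices; ''contains $k$ vertex-disjoint $P_3$'s'' means that $G$ has $k$ pairwise vertex-disjoint subgraphs isomorphic to $P_3$ ($k$ a non-negative integer). $\mathrm{MIS}(G)$ denotes the number of maximal (under inclusion) independent sets of $G$. *)

(* Defs.v *)
From HB Require Import structures.
From mathcomp Require Import all_boot all_order all_algebra.
From mathcomp Require Import reals exp.

Set Implicit Arguments.
Unset Strict Implicit.
Unset Printing Implicit Defensive.

(* A finite simple graph is a finType of vertices together with a symmetric
   and irreflexive adjacency relation. *)

Definition triangle_free (T : finType) (e : rel T) : Prop :=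
  ~ exists x y z : T, [/\ e x y, e y z & e x z].

Definition path_graph (m : nat) : rel 'I_m :=
  [rel i j : 'I_m | (i.+1 == j :> nat) || (j.+1 == i :> nat)].

(* [f] embeds [(U, h)] in [(T, e)] as a subgraph, not necessarily induced. *)
Definition subgraph_copy (U T : finType) (h : rel U) (e : rel T)
    (f : U -> T) : Prop :=
  injective f /\ {homo f : u v / h u v >-> e u v}.

Definition has_disjoint_copies (k : nat) (U T : finType) (h : rel U)
    (e : rel T) : Prop :=
  exists f : 'I_k -> U -> T,
    (forall i, subgraph_copy h e (f i)) /\
    (forall i j, i != j -> [disjoint codom (f i) & codom (f j)]).

Definition has_disjoint_P3s (k : nat) (T : finType) (e : rel T) : Prop :=
  has_disjoint_copies k (@path_graph 3) e.

Definition independent (T : finType) (e : rel T) (S : {set T}) : bool :=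
  [forall x in S, forall y in S, ~~ e x y].

Definition MIS (T : finType) (e : rel T) : nat :=
  #|[set S : {set T} | maxset (independent e) S]|.

(* Main.v *)
(** By induction on the vertex set W we bound the number of maximal independent
    sets of the graph induced on W by 2^(|W|/2 - k/25), for every packing of k
    disjoint P3's in W.  Deleting a set D of vertices lowers k by the number of
    packed paths that D meets, so each step is a branching on a vertex together
    with a count of the paths met.  At a vertex v of degree d >= 3 one deletes
    either v alone or its closed neighbourhood; if v lies on no packed path the
    former costs no path, and otherwise the latter meets at most d paths.
    Isolated vertices and leaves are branched away directly, a leaf next to a
    vertex of degree 2 gaining a factor 9/10.  In the remaining 2-regular case
    one branches around a packed path u1 - v - u2, at the other neighbour w of
    u1 if w lies on no packed path, and at v otherwise. *)

Require Import Defs.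
From HB Require Import structures.
From mathcomp Require Import all_boot all_order all_algebra.
From mathcomp Require Import reals exp.
From mathcomp Require Import zify ring lra.

Set Implicit Arguments.
Unset Strict Implicit.
Unset Printing Implicit Defensive.
Import Order.TTheory GRing.Theory Num.Theory.
Local Open Scope ring_scope.

(** * Maximal independent sets of induced subgraphs and branching inequalities *)

Section MaximalIndependentSets.
Variables (T : finType) (e : rel T).
Hypotheses (e_sym : symmetric e) (e_irr : irreflexive e).
Implicit Types (W S D : {set T}) (u v w x : T) (P Q : {set {set T}}).

Definition nbhd W v : {set T} := [set u in W | e v u].

Lemma in_nbhd W v u : (u \in nbhd W v) = (u \in W) && e v u.
Proof. by rewrite inE. Qed.

Lemma nbhd1P W v u : nbhd W v = [set u] -> u \in W /\ e v u.
Proof. by move=> nv; apply/andP; rewrite -in_nbhd nv set11. Qed.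

Lemma nbhd2P W a b c : nbhd W a = [set b; c] -> [/\ b \in W, c \in W, e a b & e a c].
Proof.
move=> na; have : b \in nbhd W a by rewrite na set21.
have : c \in nbhd W a by rewrite na set22.
by rewrite !in_nbhd => /andP [-> ->] /andP [-> ->].
Qed.

Definition cnbhd W v : {set T} := v |: nbhd W v.

(** For an independent set, domination inside [W] is equivalent to maximality, and this form
    restricts directly to smaller vertex sets. *)
Definition mis_in W S : bool :=
  [&& S \subset W, independent e S
    & [forall v in W, (v \in S) || [exists u in S, e v u]]].

Definition nmis W : nat := #|[set S | mis_in W S]|.

Lemma mis_inP W S :
  reflect [/\ {subset S <= W}, {in S &, forall x y, ~~ e x y}
    & {in W, forall v, v \notin S -> exists2 u, u \in S & e v u}]
    (mis_in W S).
Proof.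
apply: (iffP and3P) => [[/subsetP sub /forall_inP ind /forall_inP dom]|].
  split=> // [x y xS yS|v vW vS]; first exact: (forall_inP (ind x xS)).
  by move: (dom v vW); rewrite (negbTE vS) => /exists_inP.
move=> [sub ind dom]; split; first exact/subsetP.
  by apply/forall_inP=> x xS; apply/forall_inP=> y; exact: ind.
apply/forall_inP=> v vW; case: (boolP (v \in S)) => //= vS.
by apply/exists_inP; case: (dom v vW vS) => u; exists u.
Qed.

Lemma MISE : MIS e = nmis setT.
Proof.
apply: eq_card => S; rewrite !inE; apply/idP/mis_inP.
  move=> /maxsetP [indS maxS]; have indP := fun x xS => forall_inP (forall_inP indS x xS).
  split=> // [x y xS yS|v _ vS]; first exact: indP.
  apply/exists_inP; apply: contraT; rewrite negb_exists_in => /forall_inP nv.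
  suff ind' : independent e (v |: S).
    by move: vS; rewrite -(maxS _ ind' (subsetUr _ _)) setU11.
  apply/forall_inP => x /setU1P xS; apply/forall_inP => y /setU1P yS.
  case: xS yS => [->|xS] [->|yS]; rewrite ?e_irr //; first exact: nv.
    by rewrite e_sym; exact: nv.
  exact: indP.
move=> [_ ind dom]; apply/maxsetP; split.
  by apply/forall_inP=> x xS; apply/forall_inP=> y; exact: ind.
move=> S' indS' sub; apply/eqP; rewrite eqEsubset sub andbT; apply/subsetP=> v vS'.
apply: contraT => vS; case: (dom v _ vS) => [|u uS vu]; first by rewrite inE.
by move/forall_inP: indS' => /(_ v vS') /forall_inP /(_ u (subsetP sub u uS)); rewrite vu.
Qed.

Lemma card_mis_notin W v :
  (#|[set S | mis_in W S & v \notin S]| <= nmis (W :\ v))%N.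
Proof.
apply: subset_leq_card; apply/subsetP => S; rewrite !inE => /andP [/mis_inP [sub ind dom] vS].
apply/mis_inP; split=> // [x xS|x]; last by rewrite !inE => /andP [_]; exact: dom.
by rewrite !inE sub // andbT; apply: contraNneq vS => <-.
Qed.

(** Removing [v] from [S] loses no domination: vertices outside the closed neighbourhood of [v] were
    dominated by other members of [S]. *)
Lemma card_mis_in W v :
  (#|[set S | mis_in W S & v \in S]| <= nmis (W :\: cnbhd W v))%N.
Proof.
have inj : {in [set S | mis_in W S & v \in S] &, injective (fun S => S :\ v)}.
  move=> S1 S2; rewrite !inE => /andP [_ v1] /andP [_ v2] eqS.
  by rewrite -(setD1K v1) -(setD1K v2) eqS.
rewrite -(card_in_imset inj); apply: subset_leq_card; apply/subsetP => S'.
case/imsetP => S; rewrite !inE => /andP [/mis_inP [sub ind dom] vS] ->.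
apply/mis_inP; split.
- move=> x; rewrite !inE => /andP [xv xS]; rewrite (negbTE xv) sub //=.
  by rewrite andbT ind.
- by move=> x y /setD1P [_ xS] /setD1P [_ yS]; exact: ind.
move=> x; rewrite !inE negb_or negb_and => /andP [/andP [xv nb] xW].
rewrite xv /= => xS; case: (dom x xW xS) => u uS xu; exists u => //.
rewrite !inE uS andbT; apply: contraTneq xu => ->.
by move: nb; rewrite xW e_sym.
Qed.

Lemma nmis_branch W v :
  (nmis W <= nmis (W :\ v) + nmis (W :\: cnbhd W v))%N.
Proof.
apply: leq_trans (leq_add (card_mis_notin W v) (card_mis_in W v)).
apply: leq_trans (leq_card_setU _ _).
apply: subset_leq_card; apply/subsetP => S; rewrite !inE => ->.
by case: (v \in S).
Qed.

Lemma nmis_isolated W v : v \in W -> nbhd W v = set0 ->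
  (nmis W <= nmis (W :\: cnbhd W v))%N.
Proof.
move=> vW n0; apply: leq_trans (card_mis_in W v).
apply: subset_leq_card; apply/subsetP => S; rewrite !inE => mS; rewrite mS /=.
case/mis_inP: mS => sub _ dom; apply: contraT => /(dom v vW) [u uS vu].
by have := in_set0 u; rewrite -n0 inE sub // vu.
Qed.

(** A maximal set that misses the leaf [v] must contain [u], the only vertex that can dominate
    [v]. *)
Lemma nmis_leaf W v u : v \in W -> nbhd W v = [set u] ->
  (nmis W <= nmis (W :\: cnbhd W v) + nmis (W :\: cnbhd W u))%N.
Proof.
move=> vW nv; apply: leq_trans (leq_add (card_mis_in W v) (card_mis_in W u)).
apply: leq_trans (leq_card_setU _ _).
apply: subset_leq_card; apply/subsetP => S; rewrite !inE => mS; rewrite mS /=.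
case/mis_inP: mS => sub _ dom; case: (boolP (v \in S)) => //= /(dom v vW) [w wS vw].
have /set1P <- // : w \in [set u]; by rewrite -nv inE sub // vw.
Qed.

(* Sets avoiding v live in W - v, where u1 is a leaf attached to w. *)
Lemma nmis_degree2 W v u1 u2 w x : triangle_free e ->
  v \in W -> nbhd W v = [set u1; u2] -> nbhd W u1 = [set v; w] ->
  nbhd W w = [set u1; x] -> w != v ->
  (nmis W <= nmis (W :\: [set v; u1; u2]) + nmis (W :\: [set v; u1; w])
     + nmis (W :\: [set v; u1; w; x]))%N.
Proof.
move=> tf vW nv nu1 nw wv.
have [u1W u2W vu1 vu2] := nbhd2P nv.
have [_ wW u1v u1w] := nbhd2P nu1.
have [_ xW wu1 wx] := nbhd2P nw.
(* [x = v] would close the triangle [v], [u1], [w]; hence [w] keeps both neighbours once [v] is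
   deleted. *)
have xv : x != v.
  by apply: contra_notN tf => /eqP xv; move: wx; rewrite xv e_sym => vw; exists v, u1, w.
have nsub a : nbhd (W :\ v) a = nbhd W a :\ v by apply/setP=> z; rewrite !inE andbA.
have u1v' : u1 != v by apply: contraTneq vu1 => ->; rewrite e_irr.
have nu1' : nbhd (W :\ v) u1 = [set w].
  rewrite nsub nu1; apply/setP=> z; rewrite !inE.
  by case: eqVneq => [->|//]; rewrite eq_sym (negbTE wv).
have nw' : nbhd (W :\ v) w = [set u1; x].
  rewrite nsub nw; apply/setP=> z; rewrite !inE.
  by case: eqVneq => [->|//]; rewrite !(eq_sym v) (negbTE xv) (negbTE u1v').
apply: leq_trans (nmis_branch W v) _.
rewrite addnC -addnA; apply: leq_add; first by rewrite /cnbhd nv setUA.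
have u1W' : u1 \in W :\ v by rewrite !inE u1v'.
apply: leq_trans (nmis_leaf u1W' nu1') _; rewrite /cnbhd nu1' nw'.
apply: leq_add; apply: eq_leq; congr nmis; apply/setP=> z; rewrite !inE !negb_or;
  by case: (z == v); case: (z == u1); case: (z == w); case: (z == x); case: (z \in W).
Qed.

(** * Packings of disjoint three-vertex paths and the paths met by a deletion *)

Definition is_P3 (A : {set T}) : Prop :=
  exists a b c, [/\ a != c, e a b, e b c & A = [set a; b; c]].

Definition P3_packing W (P : {set {set T}}) : Prop :=
  trivIset P /\ {in P, forall A : {set T}, A \subset W /\ is_P3 A}.

Definition avoiding (P : {set {set T}}) D := [set A in P | [disjoint A & D]].

(* The number of members of the packing destroyed by deleting D. *)
Definition hits (P : {set {set T}}) D := #|P :\: avoiding P D|.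

Lemma P3_packing_avoiding W P D :
  P3_packing W P -> P3_packing (W :\: D) (avoiding P D).
Proof.
move=> [tP pP]; split.
  by apply: trivIsetS tP; apply/subsetP=> A; rewrite inE => /andP [].
by move=> A; rewrite inE => /andP [/pP [sub pA] dis]; rewrite subsetD sub dis.
Qed.

Lemma card_avoiding P D : (#|P| <= #|avoiding P D| + hits P D)%N.
Proof.
rewrite /hits -(cardsID (avoiding P D) P) leq_add2r; apply: subset_leq_card.
exact: subsetIr.
Qed.

(** Charging scheme: each path in [Q] is paid for once, however many vertices of [D] it contains; by
    disjointness each vertex of [D'] pays for at most one path; uncovered vertices are free. *)
Lemma hits_le P D (Q : {set {set T}}) D' : trivIset P -> Q \subset P ->
  {in D, forall z, z \in cover P -> z \in cover Q \/ z \in D'} ->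
  (hits P D <= #|Q| + #|D'|)%N.
Proof.
move=> tP QP DQ; apply: leq_trans (_ : (#|Q :|: [set pblock P z | z in D']| <= _)%N).
  apply: subset_leq_card; apply/subsetP=> A; rewrite !inE => /andP [nA AP].
  move: nA; rewrite AP /= => /pred0Pn [z /andP [/= zA zD]].
  have zP : z \in cover P by apply/bigcupP; exists A.
  case: (DQ z zD zP) => [/bigcupP [A' A'Q zA']|zD'].
    by rewrite -(def_pblock tP AP zA) (def_pblock tP (subsetP QP _ A'Q) zA') A'Q.
  apply/orP; right; apply/imsetP; exists z => //.
  by rewrite (def_pblock tP AP zA).
apply: leq_trans (leq_card_setU _ _) _; rewrite leq_add2l; exact: leq_imset_card.
Qed.

Lemma hits_le_card P D : trivIset P -> (hits P D <= #|D|)%N.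
Proof.
move=> tP; apply: leq_trans (hits_le (Q := set0) (D' := D) tP (sub0set _) _) _.
  by move=> z zD _; right.
by rewrite cards0.
Qed.

Lemma is_P3_nbr A v : is_P3 A -> v \in A -> exists2 u, u \in A & e v u.
Proof.
move=> [a [b [c [_ ab bc ->]]]]; rewrite !inE -orbA => /or3P [] /eqP ->.
- by exists b => //; rewrite !inE eqxx orbT.
- by exists c => //; rewrite !inE eqxx orbT.
- by exists b; [rewrite !inE eqxx orbT | rewrite e_sym].
Qed.

(** A path is connected, so its third vertex is adjacent to one of the other two; later this forces
    where a packed path continues. *)
Lemma is_P3_edge A v u : is_P3 A -> v \in A -> u \in A -> e v u ->
  exists y, [/\ y \in A, y != v, y != u & e v y || e u y].
Proof.
move=> [a [b [c [ac ab bc ->]]]] vA uA vu.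
have neq s t : e s t -> s != t by apply: contraTneq => ->; rewrite e_irr.
have ba : e b a by rewrite e_sym.
have cb : e c b by rewrite e_sym.
have ca : c != a by rewrite eq_sym.
have [aA bA cA] : [/\ a \in [set a; b; c], b \in [set a; b; c] & c \in [set a; b; c]].
  by rewrite !inE !eqxx !orbT.
move: vA uA; rewrite !inE -!orbA => /or3P [] /eqP ? /or3P [] /eqP ?; subst v u;
  first [ by rewrite e_irr in vu
        | by exists a; rewrite aA ?ac ?ca ?neq ?ab ?ba ?orbT
        | by exists b; rewrite bA ?neq ?ab ?bc ?cb ?ba ?orbT
        | by exists c; rewrite cA ?ac ?ca ?neq ?bc ?cb ?orbT].
Qed.

End MaximalIndependentSets.

(** * Numerical estimates and the effect of a deletion on the weight *)

Section Bound.
Variables (R : realType) (q : R).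
Hypotheses (q0 : 0 < q) (q50 : q ^+ 50 = 1 / 2).
Variables (T : finType) (e : rel T).
Hypotheses (e_sym : symmetric e) (e_irr : irreflexive e) (tf : triangle_free e).
Implicit Types (W S D : {set T}) (u v w x : T) (P : {set {set T}}).

Local Notation nbhd := (nbhd e).
Local Notation cnbhd := (cnbhd e).
Local Notation nmis := (nmis e).
Local Notation P3_packing := (P3_packing e).

(** Since [q ^+ 50 = 1 / 2], taking 50th powers leaves a comparison of rationals whenever [s] is
    rational. *)
Lemma exprq_le m (s : R) : 0 < s -> 1 / 2 ^+ m <= s ^+ 50 -> q ^+ m <= s.
Proof.
move=> s0 h; rewrite -(@ler_pXn2r _ 50) ?nnegrE ?exprn_ge0 ?(ltW s0) ?(ltW q0) //.
by rewrite -exprM mulnC exprM q50 expr_div_n expr1n.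
Qed.

(* The tight case: the left-hand side exceeds 0.998. *)
Lemma exprq_degree3 : q ^+ 23 + q ^+ 94 <= 1.
Proof.
have h0 : q ^+ 23 <= 7271 / 10000 by apply: exprq_le; lra.
have h1 : q ^+ 94 <= 272 / 1000 by apply: exprq_le; lra.
lra.
Qed.

(** Two vertices and one path give exponent 48; three vertices and two paths give 71. *)
Lemma exprq_leaf : q ^+ 48 + q ^+ 71 <= 9 / 10.
Proof.
have h0 : q ^+ 48 <= 515 / 1000 by apply: exprq_le; lra.
have h1 : q ^+ 71 <= 374 / 1000 by apply: exprq_le; lra.
lra.
Qed.

(** Deletions of 3, 3 and 4 vertices meeting 1, 2 and 2 paths; the factor 9/10 comes from a further
    branching at a leaf. *)
Lemma exprq_covered : 9 / 10 * q ^+ 73 + q ^+ 71 + q ^+ 96 <= 1.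
Proof.
have h0 : q ^+ 71 <= 374 / 1000 by apply: exprq_le; lra.
have h1 : q ^+ 73 <= 364 / 1000 by apply: exprq_le; lra.
have h2 : q ^+ 96 <= 265 / 1000 by apply: exprq_le; lra.
lra.
Qed.

(** Deletions of 3, 3 and 4 vertices meeting 2, 1 and 1 paths. *)
Lemma exprq_uncovered : q ^+ 71 + q ^+ 73 + q ^+ 98 <= 1.
Proof.
have h0 : q ^+ 71 <= 374 / 1000 by apply: exprq_le; lra.
have h1 : q ^+ 73 <= 364 / 1000 by apply: exprq_le; lra.
have h2 : q ^+ 98 <= 258 / 1000 by apply: exprq_le; lra.
lra.
Qed.

(* With q = 2^(-1/50) this is 2^(n/2 - k/25), written with natural exponents;
   deleting d vertices that hit h paths multiplies it by q^(25 d - 2 h). *)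
Definition weight n k : R := q ^+ (2 * k) / q ^+ (25 * n).

Definition bounded W :=
  forall P, P3_packing W P -> (nmis W)%:R <= weight #|W| #|P|.

Lemma weight_ge0 n k : 0 <= weight n k.
Proof. by rewrite divr_ge0 ?exprn_ge0 ?(ltW q0). Qed.

Lemma q_le1 : q <= 1.
Proof. by rewrite -(@ler_pXn2r _ 50) ?nnegrE ?(ltW q0) // q50 expr1n; lra. Qed.

(** The exponent of [q] rises by at least [25 d - 2 h], and [q <= 1]. The last hypothesis keeps the
    natural subtraction from truncating. *)
Lemma weight_removal W P D d h :
  D \subset W -> (d <= #|D|)%N -> (hits P D <= h)%N -> (2 * h <= 25 * d)%N ->
  weight #|W :\: D| #|avoiding P D| <= weight #|W| #|P| * q ^+ (25 * d - 2 * h).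
Proof.
move=> DW dD hD hd.
have cW : (#|W| = #|W :\: D| + #|D|)%N.
  by rewrite -(cardsID D W) (setIidPr DW) addnC.
have := card_avoiding P D; set k' := #|avoiding P D|; set k := #|P| => hk.
rewrite /weight mulrAC ler_pdivlMr ?exprn_gt0 // mulrAC.
rewrite ler_pdivrMr ?exprn_gt0 // -!exprD.
apply: ler_wiXn2l; rewrite ?(ltW q0) ?q_le1 //; lia.
Qed.

Lemma setD_proper W D : D \subset W -> (0 < #|D|)%N -> W :\: D \proper W.
Proof.
move=> DW D0; rewrite properEcard subsetDl cardsDS // ltn_subrL D0 /=.
exact: leq_trans D0 (subset_leq_card DW).
Qed.

Lemma nmis_removal W P D d h :
  (forall W', W' \proper W -> bounded W') -> P3_packing W P ->
  D \subset W -> (0 < d <= #|D|)%N -> (hits P D <= h)%N -> (2 * h <= 25 * d)%N ->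
  (nmis (W :\: D))%:R <= weight #|W| #|P| * q ^+ (25 * d - 2 * h).
Proof.
move=> IH pP DW /andP [d0 dD] hD hd.
apply: le_trans (weight_removal DW dD hD hd).
exact: IH (setD_proper DW (leq_trans d0 dD)) _ (P3_packing_avoiding D pP).
Qed.

Lemma cnbhd_sub W v : v \in W -> cnbhd W v \subset W.
Proof.
move=> vW; apply/subsetP=> z /setU1P [->//|]; by rewrite in_nbhd => /andP [].
Qed.

Lemma adj_neq v u : e v u -> v != u.
Proof. by apply: contraTneq => ->; rewrite e_irr. Qed.

Lemma card_cnbhd W v : #|cnbhd W v| = #|nbhd W v|.+1.
Proof. by rewrite cardsU1 in_nbhd e_irr andbF. Qed.

Lemma covered_nbr W P A v : P3_packing W P -> A \in P -> v \in A ->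
  exists2 u, u \in A & u \in nbhd W v.
Proof.
move=> [_ pP] AP vA; have [/subsetP sub iA] := pP A AP.
have [u uA vu] := is_P3_nbr e_sym iA vA.
by exists u; rewrite // in_nbhd sub.
Qed.

(** * Reductions at vertices of degree 0, 1 and at least 3 *)

Section Step.
Variables (W : {set T}) (P : {set {set T}}).
Hypotheses (IH : forall W', W' \proper W -> bounded W') (pP : P3_packing W P).
Let tP : trivIset P := pP.1.
Local Notation wt := (weight #|W| #|P|).

(** A packed path through [v] would give it a neighbour, so deleting [v] meets no path. *)
Lemma bound_isolated v : v \in W -> nbhd W v = set0 -> (nmis W)%:R <= wt.
Proof.
move=> vW n0; have := nmis_isolated e_sym vW n0; rewrite -(ler_nat R) => /le_trans; apply.
have hits0 : (hits P (cnbhd W v) <= 0)%N.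
  apply: leq_trans (hits_le (Q := set0) (D' := set0) tP (sub0set _) _) _.
    rewrite /cnbhd n0 setU0 => z /set1P -> /bigcupP [A AP vA].
    by have [u _] := covered_nbr pP AP vA; rewrite n0 inE.
  by rewrite !cards0.
have card1 : (0 < 1 <= #|cnbhd W v|)%N by rewrite card_cnbhd n0 cards0.
apply: le_trans (nmis_removal IH pP (cnbhd_sub vW) card1 hits0 _) _ => //.
by rewrite ler_piMr ?weight_ge0 // exprn_ile1 ?(ltW q0) ?q_le1.
Qed.

Lemma bound_degree_ge3 v : v \in W -> (2 < #|nbhd W v|)%N -> (nmis W)%:R <= wt.
Proof.
move=> vW d3; have := nmis_branch e_sym W v; rewrite -(ler_nat R) natrD => /le_trans; apply.
have card1 : (0 < 1 <= #|[set v]|)%N by rewrite cards1.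
have vW' : [set v] \subset W by rewrite sub1set.
have cN := card_cnbhd W v.
(* For degree [d >= 3], deleting [d + 1] vertices that meet at most [d] paths gives exponent
   [25 (d + 1) - 2 d = 23 d + 25 >= 94]. *)
have q_le94 m : (94 <= m)%N -> q ^+ m <= q ^+ 94.
  by move=> hm; apply: ler_wiXn2l; rewrite ?(ltW q0) ?q_le1.
have cardN : (0 < #|cnbhd W v| <= #|cnbhd W v|)%N by rewrite leqnn andbT; lia.
have wt0 := weight_ge0 #|W| #|P|.
case: (boolP (v \in cover P)) => [/bigcupP [A AP vA]|nv].
  have [u uA uN] := covered_nbr pP AP vA.
  (* v shares the path A with its neighbour u, which saves one hit. *)
  have hN : (hits P (cnbhd W v) <= #|nbhd W v|)%N.
    apply: leq_trans (hits_le (Q := [set A]) (D' := nbhd W v :\ u) tP _ _) _.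
    - by rewrite sub1set.
    - move=> z /setU1P [->|zN] _; first by left; rewrite cover1.
      case: (eqVneq z u) => [->|zu]; first by left; rewrite cover1.
      by right; rewrite !in_setD1 zu.
    by rewrite cards1 (cardsD1 u (nbhd W v)) uN.
  have hv : (hits P [set v] <= 1)%N by rewrite -(cards1 v) hits_le_card.
  have h1 := nmis_removal IH pP vW' card1 hv isT.
  have h2 := nmis_removal IH pP (cnbhd_sub vW) cardN hN ltac:(clear -cN; lia).
  apply: le_trans (lerD h1 h2) _; rewrite -mulrDr ler_piMr //.
  apply: le_trans exprq_degree3; rewrite lerD2l; apply: q_le94; clear -d3 cN; lia.
have hv : (hits P [set v] <= 0)%N.
  apply: leq_trans (hits_le (Q := set0) (D' := set0) tP (sub0set _) _) _.
    by move=> z /set1P ->; rewrite (negbTE nv).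
  by rewrite !cards0.
have hN : (hits P (cnbhd W v) <= #|nbhd W v|)%N.
  apply: leq_trans (hits_le (Q := set0) (D' := nbhd W v) tP (sub0set _) _) _.
    by move=> z /setU1P [->|zN]; [rewrite (negbTE nv) | right].
  by rewrite cards0.
have h1 := nmis_removal IH pP vW' card1 hv isT.
have h2 := nmis_removal IH pP (cnbhd_sub vW) cardN hN ltac:(clear -cN; lia).
apply: le_trans (lerD h1 h2) _; rewrite -mulrDr ler_piMr //.
(* Deleting the uncovered [v] has factor [q ^+ 25], at most the [q ^+ 23] of the tight estimate. *)
apply: le_trans exprq_degree3; apply: lerD; first by apply: ler_wiXn2l; rewrite ?(ltW q0) ?q_le1.
by apply: q_le94; clear -d3 cN; lia.
Qed.

(** [v] and [u] form a component too small for a packed path, so both branches have factor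
    [q ^+ 50 = 1 / 2] and the factors sum to exactly 1. *)
Lemma bound_K2 v u : v \in W -> nbhd W v = [set u] -> nbhd W u = [set v] ->
  (nmis W)%:R <= wt.
Proof.
move=> vW nv nu.
have [uW _] := nbhd1P nv.
have := nmis_leaf e_sym vW nv; rewrite -(ler_nat R) natrD => /le_trans; apply.
have uncov a b : nbhd W a = [set b] -> nbhd W b = [set a] -> a \notin cover P.
  move=> na nb; apply/negP => /bigcupP [A AP aA].
  have [sub iA] := pP.2 A AP.
  have [b' bA] := covered_nbr pP AP aA; rewrite na => /set1P bb; subst b'.
  have [_ ab] := nbhd1P na.
  have [y [yA /negPf ya /negPf yb]] := is_P3_edge e_sym e_irr iA aA bA ab.
  have yW := subsetP sub y yA.
  have : y \in nbhd W a = e a y by rewrite in_nbhd yW.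
  have : y \in nbhd W b = e b y by rewrite in_nbhd yW.
  by rewrite na nb !inE ya yb => <- <-.
have hit0 a b : nbhd W a = [set b] -> nbhd W b = [set a] ->
    (hits P (cnbhd W a) <= 0)%N.
  move=> na nb; apply: leq_trans (hits_le (Q := set0) (D' := set0) tP (sub0set _) _) _.
    rewrite /cnbhd na => z /set2P [] ->.
      by rewrite (negbTE (uncov _ _ na nb)).
    by rewrite (negbTE (uncov _ _ nb na)).
  by rewrite !cards0.
have card2 a b : nbhd W a = [set b] -> (0 < 2 <= #|cnbhd W a|)%N.
  by move=> na; rewrite card_cnbhd na cards1.
have h1 := nmis_removal IH pP (cnbhd_sub vW) (card2 _ _ nv) (hit0 _ _ nv nu) isT.
have h2 := nmis_removal IH pP (cnbhd_sub uW) (card2 _ _ nu) (hit0 _ _ nu nv) isT.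
apply: le_trans (lerD h1 h2) _; rewrite -mulrDr ler_piMr ?weight_ge0 //.
rewrite q50; lra.
Qed.

Lemma bound_leaf2 v u w : v \in W -> nbhd W v = [set u] -> nbhd W u = [set v; w] ->
  w != v -> (nmis W)%:R <= 9 / 10 * wt.
Proof.
move=> vW nv nu wv; have [_ wW uv uw] := nbhd2P nu.
have [uW _] := nbhd1P nv.
have := nmis_leaf e_sym vW nv; rewrite -(ler_nat R) natrD => /le_trans; apply.
(* A packed path through [v] also contains its only neighbour [u]; if [v] is uncovered, only [u] can
   be hit. Either way the pair costs at most one path. *)
have hit D' : (hits P ([set v; u] :|: D') <= 1 + #|D'|)%N.
  case: (boolP (v \in cover P)) => [/bigcupP [A AP vA]|nc].
    have [u' uA] := covered_nbr pP AP vA; rewrite nv => /set1P uu; subst u'.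
    rewrite -(cards1 A); apply: hits_le; rewrite ?sub1set // => z.
    rewrite cover1 => /setUP [/set2P [] ->|zD] _; by [left | right].
  apply: leq_trans (hits_le (Q := set0) (D' := u |: D') tP (sub0set _) _) _.
    move=> z /setUP [/set2P [] ->|zD]; rewrite ?(negbTE nc) // => _; right.
      exact: setU11.
    exact: setU1r.
  by rewrite cards0 add0n cardsU1 leq_add2r leq_b1.
have hv : (hits P (cnbhd W v) <= 1)%N.
  by have := hit set0; rewrite cards0 setU0 /cnbhd nv.
have hu : (hits P (cnbhd W u) <= 2)%N.
  by have := hit [set w]; rewrite cards1 /cnbhd nu setUA (setUC [set u]).
have cv : (0 < 2 <= #|cnbhd W v|)%N by rewrite card_cnbhd nv cards1.
have cu : (0 < 3 <= #|cnbhd W u|)%N by rewrite card_cnbhd nu cards2 eq_sym wv.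
have h1 := nmis_removal IH pP (cnbhd_sub vW) cv hv isT.
have h2 := nmis_removal IH pP (cnbhd_sub uW) cu hu isT.
apply: le_trans (lerD h1 h2) _; rewrite -mulrDr mulrC ler_wpM2r ?weight_ge0 //.
exact: exprq_leaf.
Qed.

End Step.

Lemma nbhd_other W v u : #|nbhd W v| = 2 -> u \in nbhd W v ->
  exists2 w, w != u & nbhd W v = [set u; w].
Proof.
move=> c2 uv; have /cards1P [w nw] : #|nbhd W v :\ u| == 1.
  by have := cardsD1 u (nbhd W v); rewrite uv c2 => /eq_add_S <-.
have : w \in nbhd W v :\ u by rewrite nw set11.
rewrite in_setD1 => /andP [wu _]; exists w => //.
by rewrite -(setD1K uv) nw.
Qed.

Lemma no_triangle v u w : e v u -> e u w -> ~~ e v w.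
Proof. by move=> vu uw; apply: contra_notN tf => vw; exists v, u, w. Qed.

(** * Branching along a walk [u2 - v - u1 - w - x] whose three inner vertices have degree 2 *)

Section Cycle.
Variables (W : {set T}) (P : {set {set T}}).
Hypotheses (IH : forall W', W' \proper W -> bounded W') (pP : P3_packing W P).
Let tP : trivIset P := pP.1.
Local Notation wt := (weight #|W| #|P|).
Variables (v u1 u2 w x : T).
Hypotheses (vW : v \in W) (nv : nbhd W v = [set u1; u2]) (nu1 : nbhd W u1 = [set v; w])
  (nw : nbhd W w = [set u1; x]) (u21 : u2 != u1) (wv : w != v) (xu1 : x != u1).

(** The branch deleting [v], [u1], [u2] is bounded separately, so that a sharper estimate can
    replace it in the covered case. *)
Lemma degree2_removals h1 h2 h3 :
  (hits P [set v; u1; u2] <= h1 <= 3)%N -> (hits P [set v; u1; w] <= h2 <= 3)%N ->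
  (hits P [set v; u1; w; x] <= h3 <= 4)%N ->
  [/\ (nmis W)%:R <= (nmis (W :\: [set v; u1; u2]))%:R
         + wt * (q ^+ (75 - 2 * h2) + q ^+ (100 - 2 * h3)) :> R &
      (nmis (W :\: [set v; u1; u2]))%:R <= wt * q ^+ (75 - 2 * h1)].
Proof.
move=> /andP [H1 H1'] /andP [H2 H2'] /andP [H3 H3'].
have [u1W u2W vu1 vu2] := nbhd2P nv.
have [_ wW u1v u1w] := nbhd2P nu1.
have [_ xW wu1 wx] := nbhd2P nw.
have xv : x != v.
  by apply: contraTneq wx => ->; rewrite e_sym (no_triangle vu1).
have sub1 : [set v; u1; u2] \subset W by rewrite !subUset !sub1set vW u1W.
have sub2 : [set v; u1; w] \subset W by rewrite !subUset !sub1set vW u1W.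
have sub3 : [set v; u1; w; x] \subset W by rewrite !subUset !sub1set vW u1W wW.
have vu1' := adj_neq vu1; have vu2' := adj_neq vu2.
have u1w' := adj_neq u1w; have wx' := adj_neq wx.
have c1 : (0 < 3 <= #|[set v; u1; u2]|)%N.
  by rewrite setUC cardsU1 cards2 !inE negb_or u21 vu1' eq_sym vu2'.
have c2 : (0 < 3 <= #|[set v; u1; w]|)%N.
  by rewrite setUC cardsU1 cards2 !inE negb_or wv vu1' eq_sym u1w'.
have c3 : (0 < 4 <= #|[set v; u1; w; x]|)%N.
  rewrite setUC cardsU1 [in X in (_ + X)%N]setUC cardsU1 cards2 !inE !negb_or.
  by rewrite wv vu1' xv xu1 (eq_sym x) wx' eq_sym u1w'.
split; last by apply: (nmis_removal IH pP sub1 c1 H1); clear -H1'; lia.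
have := nmis_degree2 e_sym e_irr tf vW nv nu1 nw wv.
rewrite -(ler_nat R) !natrD -addrA => /le_trans; apply.
rewrite lerD2l mulrDr; apply: lerD.
  by apply: (nmis_removal IH pP sub2 c2 H2); clear -H2'; lia.
by apply: (nmis_removal IH pP sub3 c3 H3); clear -H3'; lia.
Qed.

(** Serves both the empty packing and the case where branching is at an uncovered vertex. *)
Lemma bound_degree2_low :
  (hits P [set v; u1; u2] <= 2)%N -> (hits P [set v; u1; w] <= 1)%N ->
  (hits P [set v; u1; w; x] <= 1)%N -> (nmis W)%:R <= wt.
Proof.
move=> H1 H2 H3; have [] := @degree2_removals 2 1 1; rewrite ?H1 ?H2 ?H3 // => le0 le1.
apply: le_trans le0 _; apply: le_trans (lerD le1 (lexx _)) _.
rewrite -mulrDr ler_piMr ?weight_ge0 // addrA.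
exact: exprq_uncovered.
Qed.

(* Here the three branches alone give q^73 + q^71 + q^96 > 1; the deficit is
   recovered by branching once more, at the leaf w left by the deletion of A. *)
Lemma bound_degree2_covered A B : A \in P -> B \in P -> A = [set u1; v; u2] ->
  w \in B -> A != B -> {in W, forall z, #|nbhd W z| = 2} -> (nmis W)%:R <= wt.
Proof.
move=> AP BP defA wB AB deg2.
have dis z : z \in A -> z \in B -> False.
  move=> zA zB; move/negP: AB; apply; apply/eqP.
  by rewrite -(def_pblock tP AP zA) (def_pblock tP BP zB).
have [vA u1A u2A] : [/\ v \in A, u1 \in A & u2 \in A].
  by rewrite defA !inE !eqxx !orbT.
(* [w] has a neighbour on its own path [B]; since [u1] lies on [A], that neighbour is [x]. *)
have xB : x \in B.
  have [z zB] := covered_nbr pP BP wB; rewrite nw => /set2P [zu|<- //].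
  by case: (dis z); rewrite // zu.
have [_ xW wu1 wx] := nbhd2P nw.
have [_ wW _ _] := nbhd2P nu1.
have hB D : D \subset A :|: B -> (hits P D <= 2)%N.
  move=> /subsetP sub; have := @hits_le _ P D [set A; B] set0 tP.
  rewrite cards0 addn0 cards2 AB; apply; first by rewrite subUset !sub1set AP.
  move=> z /sub zAB _; left; apply/bigcupP; case/setUP: zAB => zi.
    by exists A; rewrite ?set21.
  by exists B; rewrite ?set22.
have hA : (hits P [set v; u1; u2] <= 1)%N.
  rewrite -(cards1 A); have := @hits_le _ P [set v; u1; u2] [set A] set0 tP.
  rewrite cards0 addn0; apply; first by rewrite sub1set.
  by move=> z zD _; left; rewrite cover1 defA (setUC [set u1]).
have H2 : (hits P [set v; u1; w] <= 2)%N.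
  by apply: hB; rewrite !subUset !sub1set !inE vA u1A wB orbT.
have H3 : (hits P [set v; u1; w; x] <= 2)%N.
  by apply: hB; rewrite !subUset !sub1set !inE vA u1A wB xB !orbT.
have [] := @degree2_removals 1 2 2; rewrite ?hA ?H2 ?H3 // => le0 _.
apply: le_trans le0 _.
have wnx : w \in nbhd W x by rewrite in_nbhd wW e_sym.
have [y yw nx] := nbhd_other (deg2 x xW) wnx.
(* The third vertex of [B] is adjacent to [w] or [x]; not being [u1], it is [y], so [y] survives the
   deletion of [A]. *)
have yB : y \in B.
  have [y' [y'B y'w y'x]] := is_P3_edge e_sym e_irr (pP.2 B BP).2 wB xB wx.
  have y'W := subsetP (pP.2 B BP).1 y' y'B.
  have nbE z : e z y' = (y' \in nbhd W z) by rewrite in_nbhd y'W.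
  rewrite !nbE nw nx !inE (negPf y'w) (negPf y'x) !orbF => /orP [/eqP y'u|/eqP <- //].
  by case: (dis y'); rewrite // y'u.
set D := [set v; u1; u2].
have DA : D = A by rewrite defA (setUC [set u1]).
have inD z : z \in B -> z \notin D by rewrite DA => zB; apply/negP=> /dis; apply.
have nD z : nbhd (W :\: D) z = nbhd W z :\: D.
  by apply/setP=> t; rewrite !inE andbA.
(* Once [A] is gone, [w] is a leaf attached to [x], which still has degree 2. *)
have nw' : nbhd (W :\: D) w = [set x].
  rewrite nD nw; apply/setP=> t; rewrite in_setD !in_set2 in_set1.
  case: (eqVneq t x) => [->|_]; first by rewrite inD ?orbT.
  by rewrite orbF; case: eqVneq => [->|_]; rewrite ?andbF // DA u1A.
have nx' : nbhd (W :\: D) x = [set w; y].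
  rewrite nD nx; apply/setP=> t; rewrite in_setD !in_set2.
  case: (eqVneq t w) => [->|_]; first by rewrite inD.
  by case: (eqVneq t y) => [->|_]; [rewrite inD | rewrite andbF].
have DW : D \subset W.
  by rewrite DA; exact: (pP.2 A AP).1.
have [D0 cD] : (0 < #|D|)%N /\ (3 <= #|D|)%N.
  suff cD : (3 <= #|D|)%N by split=> //; exact: leq_trans cD.
  have [_ _ vu1 vu2] := nbhd2P nv.
  by rewrite /D setUC cardsU1 cards2 !inE negb_or u21 (adj_neq vu1) eq_sym (adj_neq vu2).
have IH' W' : W' \proper W :\: D -> bounded W'.
  by move=> /proper_trans W'p; apply: IH; apply: W'p; exact: setD_proper.
have wD : w \in W :\: D by rewrite in_setD inD.
have leaf := bound_leaf2 IH' (P3_packing_avoiding D pP) wD nw' nx' yw.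
have red := weight_removal DW cD hA isT.
have num := exprq_covered; have wt0 := weight_ge0 #|W| #|P|.
have {red} leaf : (nmis (W :\: D))%:R <= wt * (9 / 10 * q ^+ 73).
  apply: le_trans leaf _; rewrite [leRHS]mulrCA ler_pM2l; [exact: red | lra].
apply: le_trans (lerD leaf (lexx _)) _; rewrite -mulrDr ler_piMr // addrA.
exact: num.
Qed.

(** Here the branching vertex [v] is off the packing and the packed path starts at its neighbour
    [u1]. Every deleted vertex other than [v] and [u2] lies on [A], whence the hit counts 2, 1,
    1. *)
Lemma bound_degree2_uncovered A : A \in P -> A = [set u1; w; x] ->
  v \notin cover P -> (nmis W)%:R <= wt.
Proof.
move=> AP defA vP.
have hQ D D' : D \subset v |: (A :|: D') -> (hits P D <= 1 + #|D'|)%N.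
  move=> /subsetP sub; rewrite -(cards1 A); apply: hits_le; rewrite ?sub1set //.
  move=> z /sub /setU1P [->|]; first by rewrite (negPf vP).
  by move=> /setUP [zA|zD] _; [left; rewrite cover1 | right].
have hQ1 D : D \subset v |: A -> (hits P D <= 1)%N.
  by move=> sub; have := @hQ D set0; rewrite cards0 setU0; apply.
apply: bound_degree2_low.
- have := @hQ [set v; u1; u2] [set u2]; rewrite cards1; apply.
  by rewrite defA; apply/subsetP=> z; rewrite !inE;
    case: (z == v); case: (z == u1); case: (z == u2); rewrite ?orbT.
- by apply: hQ1; rewrite defA; apply/subsetP=> z; rewrite !inE;
    case: (z == v); case: (z == u1); case: (z == w).
by apply: hQ1; rewrite defA; apply/subsetP=> z; rewrite !inE;
    case: (z == v); case: (z == u1); case: (z == w).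
Qed.

End Cycle.

(** * The 2-regular case and the induction on the vertex set *)

Lemma is_P3_degree2 W A : is_P3 e A -> A \subset W ->
  {in W, forall z, #|nbhd W z| = 2} ->
  exists v u1 u2, [/\ v \in W, u2 != u1, nbhd W v = [set u1; u2] & A = [set u1; v; u2]].
Proof.
move=> [a [b [c [ac ab bc ->]]]] /subsetP sub deg2.
have [aW bW cW] : [/\ a \in W, b \in W & c \in W].
  by split; apply: sub; rewrite !inE eqxx ?orbT.
exists b, a, c; split=> //; first by rewrite eq_sym.
have aN : a \in nbhd W b by rewrite in_nbhd aW e_sym.
have [c' _ nb] := nbhd_other (deg2 b bW) aN.
have : c \in nbhd W b by rewrite in_nbhd cW.
by rewrite nb => /set2P [ca|<- //]; rewrite ca eqxx in ac.
Qed.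

Lemma bound_2regular W P : (forall W', W' \proper W -> bounded W') ->
  P3_packing W P -> W != set0 -> {in W, forall z, #|nbhd W z| = 2} ->
  (nmis W)%:R <= weight #|W| #|P|.
Proof.
move=> IH pP /set0Pn [v0 v0W] deg2.
(* With an empty packing any vertex serves as centre; otherwise [v] is the middle of a packed
   path. *)
have [v [u1 [u2 [vW u21 nv hP]]]] : exists v u1 u2,
    [/\ v \in W, u2 != u1, nbhd W v = [set u1; u2]
      & P = set0 \/ [set u1; v; u2] \in P].
  have [P0|[A AP]] := set_0Vmem P; last first.
    have [AW iA] := pP.2 A AP.
    have [v [u1 [u2 [vW u21 nv defA]]]] := is_P3_degree2 iA AW deg2.
    by exists v, u1, u2; split=> //; right; rewrite -defA.
  have : (0 < #|nbhd W v0|)%N by rewrite deg2.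
  case/card_gt0P => u1 u1N; have [u2 u21 nv0] := nbhd_other (deg2 v0 v0W) u1N.
  by exists v0, u1, u2; split=> //; left.
have [u1W u2W vu1 vu2] := nbhd2P nv.
have vN : v \in nbhd W u1 by rewrite in_nbhd vW e_sym.
have [w wv nu1] := nbhd_other (deg2 u1 u1W) vN.
have [_ wW u1v u1w] := nbhd2P nu1.
have u1N : u1 \in nbhd W w by rewrite in_nbhd u1W e_sym.
have [x xu1 nw] := nbhd_other (deg2 w wW) u1N.
case: hP => [P0|AP].
  have h0 D : hits P D = 0%N by apply/eqP; rewrite cards_eq0 P0 set0D.
  by apply: (bound_degree2_low IH pP vW nv nu1 nw u21 wv xu1); rewrite h0.
case: (boolP (w \in cover P)) => [/bigcupP [B BP wB]|wP].
  apply: (bound_degree2_covered IH pP vW nv nu1 nw u21 wv xu1 AP BP erefl wB) => //.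
  (* [w] is off the path: [w = u2] would close the triangle [v], [u1], [u2]. *)
  apply: contraTneq wB => <-; rewrite !inE !negb_or wv.
  rewrite eq_sym (adj_neq u1w) /=; apply: contraTneq u1w => ->.
  by apply: contraL vu2 => u1u2; exact: no_triangle vu1 u1u2.
have nu1' : nbhd W u1 = [set w; v] by rewrite setUC.
(* The walk is read in reverse: branching is at the uncovered [w], with [v] and [u2] in the places
   of [w] and [x]. *)
apply: (bound_degree2_uncovered IH pP wW nw nu1' nv xu1 _ u21 AP _ wP) => //.
by rewrite eq_sym.
Qed.

Lemma bounded_all W : bounded W.
Proof.
have [m] := ubnP #|W|; elim: m W => // m IHm W /ltnSE cW.
have IH W' : W' \proper W -> bounded W'.
  by move=> /proper_card lt; apply: IHm; exact: leq_trans lt cW.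
move=> P pP; have [W0|W0] := eqVneq W set0.
  have P0 : P = set0.
    apply/setP=> A; rewrite inE; apply/negP=> /(pP.2 A) [].
    rewrite W0 subset0 => /eqP -> [a [b [c [_ _ _]]]] /setP /(_ a).
    by rewrite !inE eqxx.
  (* On the empty vertex set the weight is 1 and only the empty set can be counted. *)
  rewrite P0 W0 !cards0 /weight !muln0 expr0 divr1 -[leRHS]/(1%:R) ler_nat.
  rewrite -(cards1 (set0 : {set T})); apply: subset_leq_card.
  by apply/subsetP=> S; rewrite !inE => /and3P []; rewrite subset0.
have deg3 v : v \in W -> (2 < #|nbhd W v|)%N -> (nmis W)%:R <= weight #|W| #|P|.
  exact: bound_degree_ge3.
case: (boolP [forall v in W, #|nbhd W v| == 2]) => [/forall_inP deg2|].
  by apply: bound_2regular => // z zW; apply/eqP; exact: deg2.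
rewrite negb_forall_in => /exists_inP [v vW].
have [|lt _] := leqP 2 #|nbhd W v|.
  by rewrite leq_eqVlt eq_sym => /orP [->//|/deg3 h _]; exact: h.
case d : #|nbhd W v| lt => [|[|//]] _.
  by move/eqP: d; rewrite cards_eq0 => /eqP; exact: bound_isolated.
move/eqP: d => /cards1P [u nv].
have [uW vu] := nbhd1P nv.
have vN : v \in nbhd W u by rewrite in_nbhd vW e_sym.
(* At a leaf [v] the degree of its neighbour [u] decides: at least 3, exactly 2, or 1. *)
have [/deg3 h|] := ltnP 2 #|nbhd W u|; first exact: h.
rewrite leq_eqVlt => /orP [/eqP d2|].
  have [w wv nu] := nbhd_other d2 vN.
  apply: le_trans (bound_leaf2 IH pP vW nv nu wv) _.
  have := weight_ge0 #|W| #|P|; lra.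
rewrite ltnS => d1; apply: (bound_K2 IH pP vW nv).
by apply/esym/eqP; rewrite eqEcard sub1set vN cards1.
Qed.

End Bound.

(** * From disjoint copies to packings, and the bound as a real power of 2 *)

Lemma P3_packing_of_copies (T : finType) (e : rel T) (k : nat) :
  symmetric e -> has_disjoint_P3s k e ->
  exists2 P : {set {set T}}, P3_packing e setT P & #|P| = k.
Proof.
move=> e_sym [f [fcopy fdisj]].
pose B (i : 'I_k) : {set T} := [set x in codom (f i)].
have Bdisj i j : i != j -> [disjoint B i & B j].
  by move=> /fdisj /pred0P h; apply/pred0P=> x; have := h x; rewrite /= !inE.
have B0 i : f i ord0 \in B i by rewrite inE codom_f.
(* The blocks are disjoint and nonempty, so distinct copies give distinct vertex sets and all [k]
   are counted. *)
have Binj : injective B.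
  move=> i j eqB; apply/eqP; apply: contraT => /Bdisj; rewrite eqB => /pred0P /(_ (f j ord0)).
  by rewrite /= B0.
exists [set B i | i : 'I_k]; last by rewrite card_imset // card_ord.
split.
  apply/trivIsetP => _ _ /imsetP [i _ ->] /imsetP [j _ ->] neq.
  by apply: Bdisj; apply: contraNneq neq => ->.
move=> _ /imsetP [i _ ->]; split; first exact: subsetT.
have [finj fhom] := fcopy i.
pose p (m : nat) : 'I_3 := inord m.
exists (f i (p 0)), (f i (p 1)), (f i (p 2)); split.
- by rewrite (inj_eq finj) -val_eqE /= !inordK.
- by apply: fhom; rewrite /path_graph /= !inordK.
- by apply: fhom; rewrite /path_graph /= !inordK.
apply/setP=> x; rewrite !inE -orbA; apply/codomP/or3P => [[j ->]|].
  have <- : p j = j by apply: val_inj; rewrite /= inordK.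
  case: j => [[|[|[|//]]] /= _]; rewrite eqxx.
  - exact: Or31.
  - exact: Or32.
  - exact: Or33.
by case=> /eqP ->; eexists.
Qed.

Theorem lemma2p4 (R : realType) (T : finType) (e : rel T) (n k : nat)
    (e_sym : symmetric e) (e_irr : irreflexive e)
    (cardT : #|T| = n)
    (tf : triangle_free e)
    (hk : has_disjoint_P3s k e) :
  (MIS e)%:R <= (2 : R) `^ (n%:R / 2 - k%:R / 25).
Proof.
have [P pP cP] := P3_packing_of_copies e_sym hk.
(* With this [q], [q ^+ 25] is [2^(-1/2)] and [q ^+ 2] is [2^(-1/25)], so vertices and paths both
   carry natural exponents. *)
pose q : R := (2 `^ (1 / 50))^-1.
have q0 : 0 < q by rewrite invr_gt0 powR_gt0.
have qE m : q ^+ m = (2 `^ (m%:R / 50))^-1.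
  by rewrite exprVn -powR_mulrn ?powR_ge0 // -powRrM; congr (_ `^ _)^-1; field.
have q50 : q ^+ 50 = 1 / 2.
  have one : 50 / 50 = 1 :> R by field.
  by rewrite qE one powRr1 // div1r.
have := bounded_all q0 q50 e_sym e_irr tf pP.
rewrite -MISE // cardsT cardT cP /weight !qE invrK mulrC -powRB ?pnatr_eq0 ?implybT //.
by congr (_ <= _ `^ _); rewrite !natrM; field.
Qed.
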